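(* Let $f:\mathcal{X}\to\mathbb{R}$ and $g:\mathcal{Y}\to\mathbb{R}$ be twice continuously differentiable and strongly convex with parameters $\mu_f>0$ and $\mu_g>0$, respectively, let $A:\mathcal{X}\to\mathcal{Y}$ be a bounded linear operator, put $\mathcal{L}(x,y)=f(x)+\langle Ax,y\rangle-g(y)$, and let $(x^*,y^* )\in\mathcal{X}\times\mathcal{Y}$ be a saddle point of $\mathcal{L}$. Let $t_0\ge0$, $\gamma_0>0$, $0<\alpha\le2\sqrt{\min(\mu_f,\mu_g)\gamma_0}$, $\min(\beta_f,\beta_g)>0$, $\gamma=\gamma_0+\frac{\alpha}{2}\max(\beta_f,\beta_g)$ and $\theta=\frac{2}{\alpha}$. Let $(x,y):[t_0,\infty)\to\mathcal{X}\times\mathcal{Y}$ be a solution of the system $$\begin{cases}\ddot{x}+\alpha\dot{x}+\beta_f\nabla_{xx}\mathcal{L}(x,y)\dot{x}+\gamma\nabla_x\mathcal{L}(x,y+\theta\dot{y})=0,\\ \ddot{y}+\alpha\dot{y}-\beta_g\nabla_{yy}\mathcal{L}(x,y)\dot{y}-\gamma\nabla_y\mathcal{L}(x+\theta\dot{x},y)=0.\end{cases}$$ Then: (i) $\|x(t)-x^*\|^2+\|y(t)-y^*\|^2=\mathcal{O}\left(e^{-\frac12\alpha t}\right)$; (ii) $\|\dot{x}(t)\|^2+\|\dot{y}(t)\|^2=\mathcal{O}\left(e^{-\frac12\alpha t}\right)$; (iii) $\mathcal{L}(x(t),y^* )-\mathcal{L}(x^*,y(t))=\mathcal{O}\left(e^{-\frac12\alpha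 t}\right)$. Here $u(t)=\mathcal{O}(v(t))$ means that there is a constant $C$ independent of $t$ with $|u(t)|\le C\,v(t)$ for every $t\ge t_0$.
   Context: $\mathcal{X}$ and $\mathcal{Y}$ are real Hilbert spaces; $A^*:\mathcal{Y}\to\mathcal{X}$ is the adjoint of $A$. A saddle point $(x^*,y^* )$ of $\mathcal{L}$ satisfies $\mathcal{L}(x^*,y)\le\mathcal{L}(x^*,y^* )\le\mathcal{L}(x,y^* )$ for all $(x,y)\in\mathcal{X}\times\mathcal{Y}$; equivalently $\nabla f(x^* )+A^*y^*=0$ and $\nabla g(y^* )-Ax^*=0$. A function $\phi$ is strongly convex with parameter $\mu>0$ if $\phi-\frac{\mu}{2}\|\cdot\|^2$ is convex. The functions $x,y$ are evaluated at $t$ in the system, and a solution is a twice differentiable function satisfying the system on $[t_0,\infty)$. Explicitly, $\nabla_x\mathcal{L}(x,y)=\nabla f(x)+A^*y$, $\nabla_y\mathcal{L}(x,y)=Ax-\nabla g(y)$, $\nabla_{xx}\mathcal{L}(x,y)=\nabla^2 f(x)$, $\nabla_{yy}\mathcal{L}(x,y)=-\nabla^2 g(y)$. *)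

(* Defs.v *)
From HB Require Import structures.
From mathcomp Require Import all_boot all_order all_algebra sesquilinear.
From mathcomp Require Import all_classical all_reals all_analysis.

Set Implicit Arguments.
Unset Strict Implicit.
Unset Printing Implicit Defensive.

Import Order.TTheory GRing.Theory Num.Theory.
Import numFieldNormedType.Exports.

Local Open Scope classical_set_scope.
Local Open Scope ring_scope.

HB.mixin Record NormedModule_isHilbert (R : realType) V
    & CompleteNormedModule R V := {
  inner : {dot V for (@idfun R)} ;
  inner_norm : forall x : V, inner x x = `|x| ^+ 2
}.

#[short(type="hilbertType")]
HB.structure Definition Hilbert (R : realType) :=
  {V of CompleteNormedModule R V & NormedModule_isHilbert R V}.

Section Calculus.
Context {R : realType}.

(* The Riesz representative of the Frechet differential; it exists and is
   unique where f is differentiable. *)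
Definition grad {X : hilbertType R} (f : X -> R) (x : X) : X :=
  xget 0 [set v : X | forall h, 'd f x h = inner v h].

Definition hess {X : hilbertType R} (f : X -> R) (x : X) : X -> X :=
  'd (grad f) x.

(* Continuity of 'd F is with respect to the operator norm. *)
Definition cont_diff {V W : normedModType R} (F : V -> W) : Prop :=
  (forall x, differentiable F x) /\
  (forall x (e : R), 0 < e ->
     \forall y \near x, forall h, `|'d F y h - 'd F x h| <= e * `|h|).

Definition twice_cont_diff {X : hilbertType R} (f : X -> R) : Prop :=
  cont_diff f /\ cont_diff (grad f).

Definition strongly_convex {X : hilbertType R} (mu : R) (f : X -> R) : Prop :=
  convex_function [set: X] (fun x : X => f x - mu / 2 * `|x| ^+ 2).

(* Derivatives relative to a set D of times: on `[t0, +oo[ they are one-sided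
   at t0 and do not depend on the values of z at times before t0. *)
Definition derivable_on {V : normedModType R} (D : set R) (z : R -> V)
    (t : R) : Prop :=
  cvg ((fun s => (s - t)^-1 *: (z s - z t)) @ within D t^').

Definition derive_on {V : normedModType R} (D : set R) (z : R -> V)
    (t : R) : V :=
  lim ((fun s => (s - t)^-1 *: (z s - z t)) @ within D t^').

Definition twice_derivable_on {V : normedModType R} (D : set R) (z : R -> V) :=
  forall t, D t -> derivable_on D z t /\ derivable_on D (derive_on D z) t.

Definition bigO_on (D : set R) (u v : R -> R) : Prop :=
  exists C : R, forall t, D t -> `|u t| <= C * v t.

End Calculus.

Section SaddlePoint.
Context {R : realType} {X Y : hilbertType R}.

Definition lagrangian (f : X -> R) (g : Y -> R) (A : X -> Y) (x : X) (y : Y)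
    : R :=
  f x + inner (A x) y - g y.

Definition saddle_point (L : X -> Y -> R) (xs : X) (ys : Y) : Prop :=
  forall x y, L xs y <= L xs ys /\ L xs ys <= L x ys.

Definition grad_x (L : X -> Y -> R) (x : X) (y : Y) : X :=
  grad (fun u => L u y) x.

Definition grad_y (L : X -> Y -> R) (x : X) (y : Y) : Y := grad (L x) y.

Definition hess_xx (L : X -> Y -> R) (x : X) (y : Y) : X -> X :=
  hess (fun u => L u y) x.

Definition hess_yy (L : X -> Y -> R) (x : X) (y : Y) : Y -> Y := hess (L x) y.

Definition system_solution (L : X -> Y -> R)
    (t0 alpha beta_f beta_g gamma theta : R) (x : R -> X) (y : R -> Y) : Prop :=
  let I := `[t0, +oo[%classic in
  let x' := derive_on I x in let x'' := derive_on I x' in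
  let y' := derive_on I y in let y'' := derive_on I y' in
  [/\ twice_derivable_on I x, twice_derivable_on I y &
    forall t, I t ->
      x'' t + alpha *: x' t + beta_f *: hess_xx L (x t) (y t) (x' t)
        + gamma *: grad_x L (x t) (y t + theta *: y' t) = 0 /\
      y'' t + alpha *: y' t - beta_g *: hess_yy L (x t) (y t) (y' t)
        - gamma *: grad_y L (x t + theta *: x' t) (y t) = 0].

End SaddlePoint.

(* Main.v *)
(** Put a := alpha / 2, u := x - xs, v := y - ys, p := grad f x - grad f xs, and
   let phi be the Bregman divergence of f at xs. The energy of x is
     (gamma - a beta_f) phi + a beta_f <p, u> + |a u + x'|^2 / 2.
   The middle term accounts for the Hessian damping, because
   <hess f x', u> = d/dt (<p, u> - phi). The coupling forces are A^* and - A
   applied to (a v + y') / a and (a u + x') / a, so they cancel when the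
   analogous energy of y is added. Since gamma - a beta_f >= gamma0 and
   a^2 <= gamma0 mu_f, strong convexity gives E' <= - a E for the sum E, hence
   E = O(exp(- a t)), and E controls all the quantities of interest. *)
Require Import Defs.
From HB Require Import structures.
From mathcomp Require Import all_boot all_order all_algebra sesquilinear.
From mathcomp Require Import all_classical all_reals all_analysis.
From mathcomp Require Import ring lra.

Set Implicit Arguments.
Unset Strict Implicit.
Unset Printing Implicit Defensive.

Import Order.TTheory GRing.Theory Num.Theory.
Import numFieldNormedType.Exports.

Local Open Scope classical_set_scope.
Local Open Scope ring_scope.

(** * Bilinearity and continuity of the inner product *)

Section InnerProduct.
Context {R : realType} {X : hilbertType R}.
Implicit Types u v w : X.

Lemma innerC u v : inner u v = inner v u.
Proof. by rewrite hermC expr0 mul1r. Qed.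

Lemma innerDl u v w : inner (u + v) w = inner u w + inner v w.
Proof. exact: linearDl. Qed.

Lemma innerDr u v w : inner w (u + v) = inner w u + inner w v.
Proof. exact: linearDr. Qed.

Lemma innerNl u v : inner (- u) v = - inner u v.
Proof. exact: linearNl. Qed.

Lemma innerNr u v : inner u (- v) = - inner u v.
Proof. exact: linearNr. Qed.

Lemma innerZl (a : R) u v : inner (a *: u) v = a * inner u v.
Proof. exact: linearZl_LR. Qed.

Lemma innerZr (a : R) u v : inner u (a *: v) = a * inner u v.
Proof. by rewrite innerC innerZl innerC. Qed.

Definition innerE := (innerDl, innerDr, innerNl, innerNr, innerZl, innerZr).

Lemma inner_ge0 u : 0 <= inner u u.
Proof. by rewrite inner_norm sqr_ge0. Qed.

Lemma inner_scaleD (k : R) u v : inner (k *: u + v) (k *: u + v) =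
  k ^+ 2 * inner u u + 2 * k * inner u v + inner v v.
Proof. by rewrite !innerE (innerC v u); ring. Qed.

Lemma inner_extl u v : (forall h, inner u h = inner v h) -> u = v.
Proof.
move=> uv; apply/eqP; rewrite -subr_eq0 -normr_eq0 -sqrf_eq0 -inner_norm.
by rewrite innerDl innerNl uv subrr.
Qed.

Lemma inner_polarization u v :
  inner u v = 2^-1 * (`|u + v| ^+ 2 - `|u| ^+ 2 - `|v| ^+ 2).
Proof. by rewrite -!inner_norm !innerE (innerC v u); field. Qed.

(** Polarization writes the inner product through norms, whose continuity is known; this gives joint
    continuity. *)
Lemma cvg_inner {T : Type} {F : set_system T} {FF : Filter F} (u v : T -> X)
    (a b : X) :
  u @ F --> a -> v @ F --> b -> (fun s => inner (u s) (v s)) @ F --> inner a b.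
Proof.
move=> ua vb.
have sq (w : T -> X) c : w @ F --> c ->
    (fun s => `|w s| ^+ 2) @ F --> `|c| ^+ 2.
  by move=> wc; rewrite expr2; apply: cvgM; apply: cvg_norm.
rewrite inner_polarization.
under eq_fun do rewrite inner_polarization.
apply: cvgM; first exact: cvg_cst.
by apply: cvgB; [apply: cvgB|]; apply: sq => //; apply: cvgD.
Qed.

End InnerProduct.

(** * Riesz representation of continuous linear functionals *)

Section Riesz.
Context {R : realType} {X : hilbertType R}.

(* The representative minimizes [|x|^2 - 2 l x]; near-minimizers form a Cauchy
   filter by the parallelogram identity. *)
Lemma riesz_representation (l : {linear X -> R}) :
  continuous l -> exists v, forall h, l h = inner v h.
Proof.
move=> lcont; have lZ a x : l (a *: x) = a * l x by exact: linearZ.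
pose J x : R := inner x x - 2 * l x.
have [M M0 lM] : exists2 M : R, 0 < M & forall x, `|l x| <= M * `|x|.
  have /linear_boundedP/pinfty_ex_gt0 [M M0 lM] : bounded_near l (nbhs 0).
    exact/continuous_linear_bounded/lcont.
  by exists M.
have Jlb x : - M ^+ 2 <= J x.
  rewrite /J inner_norm; have := lM x; have := ler_norm (l x).
  by move=> /le_trans /[apply] lx; have := sqr_ge0 (`|x| - M); lra.
have Jcont : continuous J.
  move=> x; apply: cvgB; first by apply: cvg_inner; exact: cvg_id.
  by apply: cvgM; [exact: cvg_cst|exact: lcont].
pose d := inf (range J).
have hinf : has_inf (range J).
  by split; [exists (J 0), 0|exists (- M ^+ 2) => _ [x _ <-]].
have dJ x : d <= J x by apply: ge_inf; [exact: hinf.2|exists x].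
have nearmin e : 0 < e -> exists x, J x < d + e.
  by move=> e0; have [_ [x _ <-] ?] := inf_adherent e0 hinf; exists x.
have par x y : inner (x - y) (x - y) <= 2 * (J x - d) + 2 * (J y - d).
  have := dJ (2^-1 *: (x + y)); rewrite /J !innerE lZ linearD.
  by rewrite (innerC y x); lra.
pose F := filter_from [set e : R | 0 < e] (fun e => [set x | J x < d + e]).
have FF : ProperFilter F.
  apply: filter_from_proper; last by move=> e /nearmin.
  apply: filter_from_filter; first by exists 1 => /=.
  move=> i j /= i0 j0; exists (Num.min i j); first by rewrite /= lt_min i0.
  by move=> x /=; rewrite -ltrBlDl lt_min !ltrBlDl => /andP.
have /cauchy_cvgP : cauchy F.
  apply: cauchy_exP => e /= e0.
  (* With both points within [e ^+ 2 / 4] of the infimum, [par] bounds their squared distance by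
     [e ^+ 2]. *)
  have e20 : 0 < e ^+ 2 / 4 by rewrite divr_gt0 ?exprn_gt0.
  have [x xd] := nearmin _ e20; exists x; exists (e ^+ 2 / 4) => //= y /= yd.
  rewrite -ball_normE /= -(@ltr_pXn2r _ 2) ?nnegrE ?(ltW e0)//.
  by rewrite -inner_norm (le_lt_trans (par _ _))//; lra.
move=> /cvg_ex [v Fv].
have Jv x : J v <= J x.
  apply: le_trans (dJ x); apply/ler_addgt0Pr => e e0.
  apply: (@cvgr_to_le _ F FF _ J).
    by apply: cvg_trans (Jcont v); apply: cvg_app.
  by exists e => //= z /= /ltW.
exists v => h; apply/eqP; rewrite -subr_eq0 -sqrf_eq0; apply/eqP.
set c := l h - inner v h.
have key s : 0 <= s ^+ 2 * inner h h - 2 * s * c.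
  have := Jv (v + s *: h); rewrite /J !innerE linearD lZ /c.
  by rewrite (innerC h v); lra.
(* This [s] makes the quadratic in [key] a negative multiple of [c ^+ 2], forcing [c = 0]; the
   summand 1 keeps the denominator positive even for [h = 0]. *)
have N0 := inner_ge0 h; have := key (c / (1 + inner h h)).
rewrite (_ : _ - _ = - (c ^+ 2 * ((2 + inner h h) / (1 + inner h h) ^+ 2))).
  rewrite oppr_ge0 pmulr_lle0; last first.
    by rewrite divr_gt0 ?exprn_gt0//; lra.
  by move=> c0; apply: le_anti; rewrite c0 sqr_ge0.
by field; lra.
Qed.

End Riesz.

(** * Gradients, Hessians and strong convexity *)

Section Gradient.
Context {R : realType} {X : hilbertType R}.
Implicit Types (f : X -> R) (x v w h : X).

(** Riesz supplies a representative, so [xget] in [grad] returns one instead of its default 0. *)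
Lemma inner_grad f x h : differentiable f x -> inner (grad f x) h = 'd f x h.
Proof.
move=> df; have [v vE] := riesz_representation (diff_continuous df).
by have := xgetPex 0
  (ex_intro [set w | forall k, 'd f x k = inner w k] v vE) => ->.
Qed.

Lemma grad_eq f x v : (forall h, 'd f x h = inner v h) -> grad f x = v.
Proof.
move=> fv; apply/esym/inner_extl => h; rewrite -fv.
by have := xgetPex 0
  (ex_intro [set w | forall k, 'd f x k = inner w k] v fv) => ->.
Qed.

Lemma is_diff_inner w x : is_diff x (inner w : X -> R) (inner w).
Proof.
have lin : linear (inner w : X -> R).
  by move=> a u v; rewrite innerDr innerZr.
pose linM := GRing.isLinear.Build _ _ _ _ _ lin.
pose L : {linear X -> R} := HB.pack (inner w : X -> R) linM.
have cL : continuous L.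
  by move=> y; apply: cvg_inner; [exact: cvg_cst|exact: cvg_id].
apply: DiffDef; first exact: (linear_differentiable (f := L)).
exact: (diff_lin (f := L)).
Qed.

(** Each partial map of the Lagrangian has the form of [k], with [s = 1] for [f] and [s = - 1] for
    [g]. *)
Lemma grad_affine_perturbation f k x (s c : R) w : differentiable f x ->
  (forall u, k u = s * f u + inner w u + c) ->
  grad k x = s *: grad f x + w.
Proof.
move=> df kE; apply: grad_eq => h.
have /funext -> : k =1 s \*: f + inner w + cst c by move=> u; rewrite kE.
have dw := is_diff_inner w x.
have df' := differentiableP df.
by rewrite diff_val /= !fctE/= addr0 innerDl innerZl inner_grad.
Qed.

Lemma hess_affine_perturbation f k x (s c : R) w h :
  (forall y, differentiable f y) -> differentiable (grad f) x ->
  (forall u, k u = s * f u + inner w u + c) ->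
  hess k x h = s *: hess f x h.
Proof.
move=> df dg kE; rewrite /hess.
have -> : grad k = s *: grad f + cst w.
  by apply/funext => u; rewrite (grad_affine_perturbation (df u) kE).
have dg' := differentiableP dg.
by rewrite diff_val /= !fctE addr0.
Qed.

(** The limit is taken from the right because minimality and convexity are divided by a positive [s]
    before passing to the limit. *)
Lemma cvg_right_difference_quotient f x v : differentiable f x ->
  s^-1 * (f (s *: v + x) - f x) @[s --> 0^'+] --> inner (grad f x) v.
Proof.
move=> df; rewrite inner_grad// -(deriveE v df).
have dv : s^-1 *: (f (s *: v + x) - f x) @[s --> 0^'] --> 'D_v f x.
  exact: diff_derivable.
apply: cvg_trans dv; apply: cvg_app; apply: within_subset => s /= s0.
by rewrite gt_eqF.
Qed.

(** At a minimum every directional derivative is nonnegative; the direction opposite to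
    [grad f x + w] then forces this vector to vanish. *)
Lemma grad_minimizer f x w : differentiable f x ->
  (forall u, f x + inner w x <= f u + inner w u) -> grad f x = - w.
Proof.
move=> df fmin; have ge0 h : 0 <= inner (grad f x + w) h.
  rewrite innerDl -lerBlDr sub0r.
  apply: (cvgr_to_ge (cvg_right_difference_quotient (v := h) df)); near=> s.
  have s0 : 0 < s by near: s; exact: nbhs_right_gt.
  have := fmin (s *: h + x); rewrite innerDr innerZr => fs.
  by rewrite ler_pdivlMl// mulrN; lra.
apply/eqP; rewrite -subr_eq0 opprK -normr_eq0 -sqrf_eq0 -inner_norm.
have := ge0 (- (grad f x + w)); rewrite innerNr oppr_ge0 => le0.
by apply/eqP/le_anti; rewrite le0 inner_ge0.
Unshelve. all: by end_near. Qed.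

Lemma strong_convexity_lower_bound f (mu : R) x y :
  strongly_convex mu f -> differentiable f x ->
  f x + inner (grad f x) (y - x) + mu / 2 * inner (y - x) (y - x) <= f y.
Proof.
move=> fc df; pose v := y - x.
have yE : y = x + v by rewrite /v addrCA subrr addr0.
(* Convexity on the segment leaves the defect [mu / 2 * s * (1 - s) * |v|^2]. After division by [s],
   its part depending on [s] is put into [q], where it vanishes in the limit, so the bound in [q_le]
   is free of [s]. *)
pose q (s : R) := s^-1 * (f (s *: v + x) - f x) - mu / 2 * s * inner v v.
have q_le s : 0 < s -> s < 1 -> q s <= f y - f x - mu / 2 * inner v v.
  move=> s0 s1.
  have conv_s : f (s *: y + (1 - s) *: x)
        - mu / 2 * `|s *: y + (1 - s) *: x| ^+ 2
      <= s * (f y - mu / 2 * `|y| ^+ 2) + (1 - s) * (f x - mu / 2 * `|x| ^+ 2).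
    exact: fc (Itv01 (ltW s0) (ltW s1)) y x (in_setT _) (in_setT _).
  rewrite /q; have -> : s *: v + x = s *: y + (1 - s) *: x.
    by rewrite /v scalerBr scalerBl scale1r -addrA (addrC (- _)).
  rewrite lerBlDr ler_pdivrMl//; move: conv_s; set A := f (_ + _).
  rewrite -!inner_norm /v !innerE (innerC x y).
  by nra.
have qcvg : q @ 0^'+ --> inner (grad f x) v.
  rewrite (_ : inner _ v = inner (grad f x) v - mu / 2 * 0 * inner v v);
    last by ring.
  apply: cvgB; first exact: cvg_right_difference_quotient.
  apply: cvgM; last exact: cvg_cst.
  apply: cvgM; first exact: cvg_cst.
  by apply: cvg_at_right_filter; exact: cvg_id.
have : inner (grad f x) v <= f y - f x - mu / 2 * inner v v.
  apply: (cvgr_to_le qcvg); near=> s; apply: q_le; near: s.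
    exact: nbhs_right_gt.
  exact: nbhs_right_lt.
by rewrite /v; lra.
Unshelve. all: by end_near. Qed.

Lemma hess_inner_ge0 f (mu : R) x h :
  0 <= mu -> strongly_convex mu f ->
  (forall y, differentiable f y) -> differentiable (grad f) x ->
  0 <= inner (hess f x h) h.
Proof.
move=> mu0 fc df dg.
(* Adding the two lower bounds, based at [x] and at [y], gives monotonicity of the gradient. *)
have mono y : 0 <= inner (grad f y - grad f x) (y - x).
  have fxy := strong_convexity_lower_bound y fc (df x).
  have fyx := strong_convexity_lower_bound x fc (df y).
  move: fxy fyx (mulr_ge0 mu0 (inner_ge0 (y - x))).
  rewrite -(opprB y x) !innerNr innerNl opprK.
  rewrite [inner (_ - grad f x) _]innerDl innerNl.
  move: (inner (y - x) (y - x)) (inner (grad f x) (y - x)).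
  by move: (inner (grad f y) (y - x)) (f x) (f y) => b fx fy q a; lra.
rewrite /hess -deriveE//.
have dh : s^-1 *: (grad f (s *: h + x) - grad f x) @[s --> 0^']
    --> 'D_h (grad f) x.
  exact: diff_derivable.
apply: (cvgr_to_ge (cvg_inner dh (cvg_cst h))).
near=> s => /=.
have s0 : s != 0 by near: s; exact: nbhs_dnbhs_neq.
have := mono (s *: h + x); rewrite addrK innerZr innerZl => sm.
(* The limit is two-sided, so [s] may be negative; multiplying by [s ^+ 2] keeps the sign and turns
   the quotient into [sm]. *)
rewrite -(pmulr_rge0 (x := s ^+ 2)) ?exprn_even_gt0//.
by rewrite expr2 mulrA mulfK.
Unshelve. all: by end_near. Qed.

End Gradient.

(** * Calculus along curves, with one-sided derivatives at the initial time *)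

Section Curves.
Context {R : realType}.

Lemma cvg_shift_nbhs (t : R) : h *: 1 + t @[h --> (0 : R)] --> t.
Proof.
rewrite -[X in _ --> X]add0r -[X in X + _](mulr0 0);
  apply: cvgD; last exact: cvg_cst.
rewrite mulr0 -[X in _ --> X](scale0r (1 : R)).
by apply: cvgZ; [exact: cvg_id|exact: cvg_cst].
Qed.

(** This is the substitution [s = h + t] between the quotient of [derive_on] and that of ['D_1],
    whose increment is [h *: 1]. *)
Lemma cvg_shift_dnbhs (t : R) : h *: 1 + t @[h --> (0 : R)^'] --> t^'.
Proof.
move=> P tP.
have : \forall h \near (0 : R), h *: 1 + t != t -> P (h *: 1 + t).
  exact: cvg_shift_nbhs tP.
apply: (@filterS _ (nbhs (0 : R))) => h hP h0; apply: hP.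
by rewrite /GRing.scale /= mulr1 -subr_eq0 addrK.
Qed.

(** At an interior time, restricting to [D] does not change the punctured neighbourhood filter, so
    ordinary differentiation rules become available. *)
Lemma is_derive_derive_on {V : normedModType R} (D : set R) (z : R -> V) t :
  (\near t, D t) -> derivable_on D z t -> is_derive t 1 z (derive_on D z t).
Proof.
move=> Dt zt.
have dz : (s - t)^-1 *: (z s - z t) @[s --> t^'] --> derive_on D z t.
  apply: cvg_trans zt; apply: cvg_app => P; rewrite /within /= => tP.
  have Dt' : t^' D by exact: cvg_within Dt.
  by apply: (@filterS2 _ t^' _ _ _ _ _ Dt' tP) => s Ds; exact.
have dz0 : h^-1 *: (z (h *: 1 + t) - z t) @[h --> 0^'] --> derive_on D z t.
  apply: cvg_trans (cvg_comp _ _ (@cvg_shift_dnbhs t) dz).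
  apply: near_eq_cvg; apply: nearW => h /=.
  by rewrite addrK [h *: 1]mulr1.
apply: DeriveDef; first by apply/cvg_ex; exists (derive_on D z t).
exact: cvg_lim dz0.
Qed.

(** Write [z s] as [z t] plus [s - t] times a convergent quotient. This serves the initial time,
    where only the right-hand limit is meaningful. *)
Lemma cvg_at_right_derivable_on {V : normedModType R} (z : R -> V) t :
  derivable_on `[t, +oo[ z t -> z s @[s --> t^'+] --> z t.
Proof.
move=> zt.
have dz : (s - t)^-1 *: (z s - z t) @[s --> t^'+] --> derive_on `[t, +oo[ z t.
  apply: cvg_trans zt; apply: cvg_app => P; rewrite /within /dnbhs /at_right /=.
  apply: (@filterS _ (nbhs t)) => s Ps ts; apply: Ps; first by rewrite gt_eqF.
  by rewrite in_itv/= (ltW ts).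
have : (s - t) *: ((s - t)^-1 *: (z s - z t)) + z t @[s --> t^'+]
    --> (t - t) *: derive_on `[t, +oo[ z t + z t.
  apply: cvgD; last exact: cvg_cst.
  apply: cvgZ => //; apply: cvgB; last exact: cvg_cst.
  by apply: cvg_at_right_filter; exact: cvg_id.
rewrite subrr scale0r add0r; apply: cvg_trans; apply: near_eq_cvg.
near=> s; have ts : t < s by near: s; exact: nbhs_right_gt.
have st : s - t != 0 by rewrite subr_eq0 gt_eqF.
by rewrite /= scalerA (mulfV st) scale1r subrK.
Unshelve. all: by end_near. Qed.

Lemma is_derive_comp_diff {V W : normedModType R} (F : V -> W) (u : R -> V) t
    du :
  differentiable F (u t) -> is_derive t 1 u du ->
  is_derive t 1 (F \o u) ('d F (u t) du).
Proof.
move=> dF [du1 <-].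
have du' : differentiable u t by exact/derivable1_diffP.
have dFu : differentiable (F \o u) t by exact: differentiable_comp.
apply: DeriveDef; first exact/derivable1_diffP.
by rewrite (deriveE _ dFu) (deriveE _ du') diff_comp.
Qed.

(** The increment splits as in the usual product rule; continuity of [v] handles the factor taken at
    the shifted time. *)
Lemma is_derive_inner {X : hilbertType R} (u v : R -> X) (t : R)
    (du dv : X) :
  is_derive t 1 u du -> is_derive t 1 v dv ->
  is_derive t 1 (fun s => inner (u s) (v s)) (inner du (v t) + inner (u t) dv).
Proof.
move=> [du1 <-] [dv1 <-].
have vt : v (h *: 1 + t) @[h --> 0^'] --> v t.
  have vc : v s @[s --> t] --> v t.
    by apply: differentiable_continuous; exact/derivable1_diffP.
  apply: cvg_comp vc; apply: cvg_within_filter; exact: cvg_shift_nbhs.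
have : inner (h^-1 *: (u (h *: 1 + t) - u t)) (v (h *: 1 + t))
   + inner (u t) (h^-1 *: (v (h *: 1 + t) - v t)) @[h --> 0^'] -->
   inner ('D_1 u t) (v t) + inner (u t) ('D_1 v t).
  by apply: cvgD; apply: cvg_inner => //; exact: cvg_cst.
rewrite (_ : (fun h => _) = (fun h =>
    h^-1 *: (inner (u (h *: 1 + t)) (v (h *: 1 + t)) - inner (u t) (v t))));
  last first.
  by apply/funext => h; rewrite !innerE /GRing.scale/=; ring.
move=> uv; apply: DeriveDef; last exact: cvg_lim uv.
by apply/cvg_ex; exists (inner ('D_1 u t) (v t) + inner (u t) ('D_1 v t)).
Qed.

End Curves.

(** * The energy of one player: bounds, dissipation and regularity *)

Section Energy.
Context {R : realType} {X : hilbertType R}.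
Implicit Types (f : X -> R) (x v : X).

Definition bregman f xs x : R := f x - f xs - inner (grad f xs) (x - xs).

Definition energy f xs (a c beta : R) x v : R :=
  c * bregman f xs x + a * beta * inner (grad f x - grad f xs) (x - xs)
  + 2^-1 * inner (a *: (x - xs) + v) (a *: (x - xs) + v).

(* The time derivative of [energy] along a curve with velocity [v] and
   acceleration [v2]. *)
Definition energy_rate f xs (a c beta : R) x v v2 : R :=
  c * inner (grad f x - grad f xs) v
  + a * beta * (inner (hess f x v) (x - xs) + inner (grad f x - grad f xs) v)
  + inner (a *: v + v2) (a *: (x - xs) + v).

(** The strong convexity bound is used from [xs] to [x] and from [x] to [xs]: the right-hand side of
    the second inequality is the Bregman divergence with its two points exchanged. *)
Lemma bregman_bounds f xs (mu : R) x : strongly_convex mu f ->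
  (forall y, differentiable f y) ->
  mu / 2 * inner (x - xs) (x - xs) <= bregman f xs x /\
  mu / 2 * inner (x - xs) (x - xs)
    <= inner (grad f x - grad f xs) (x - xs) - bregman f xs x.
Proof.
move=> fc df; have := strong_convexity_lower_bound x fc (df xs).
have := strong_convexity_lower_bound xs fc (df x).
rewrite -(opprB x xs) !innerNr innerNl opprK /bregman.
rewrite [inner (_ - grad f xs) _]innerDl innerNl.
move: (inner (x - xs) (x - xs)) (inner (grad f xs) (x - xs)).
move: (inner (grad f x) (x - xs)).
by move: (f x) (f xs) => fx fxs b' q b h1 h2; split; lra.
Qed.

Lemma energy_bounds f xs (mu a c beta g0 : R) x v : strongly_convex mu f ->
  (forall y, differentiable f y) ->
  0 < mu -> 0 < a -> 0 < g0 -> g0 <= c -> a ^+ 2 <= g0 * mu -> 0 <= beta ->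
  [/\ 0 <= bregman f xs x,
      g0 * bregman f xs x <= energy f xs a c beta x v,
      a ^+ 2 * inner (x - xs) (x - xs) <= 2 * energy f xs a c beta x v &
      inner v v <= 8 * energy f xs a c beta x v].
Proof.
move=> fc df mu0 a0 g00 g0c amu beta0.
have [b1 b2] := bregman_bounds xs x fc df.
have u0 := inner_ge0 (x - xs).
have w0 := inner_ge0 (a *: (x - xs) + v).
(* With [u := x - xs], this says [|v|^2 <= 2 |a u + v|^2 + 2 |a u|^2]. Each summand is at most 4
   times the energy, whence the constant 8. *)
have p0 : 0 <= inner (2 *: (a *: (x - xs)) + v) (2 *: (a *: (x - xs)) + v).
  exact: inner_ge0.
move: w0 p0; rewrite /energy scalerA !inner_scaleD.
move: b1 b2 u0; move: (inner (grad f x - grad f xs) (x - xs)).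
move: (inner (x - xs) v) (inner v v).
move: (inner (x - xs) (x - xs)) (bregman f xs x) => U b uv V pu b1 b2 u0 w0 p0.
have mU : 0 <= mu / 2 * U by rewrite mulr_ge0// divr_ge0// ltW.
have b0 : 0 <= b by exact: le_trans b1.
have g0b : 0 <= g0 * b by rewrite mulr_ge0// ltW.
have apu : 0 <= a * beta * pu by rewrite !mulr_ge0 ?(ltW a0)//; lra.
have cb : g0 * b <= c * b by exact: ler_wpM2r.
have gb : g0 * (mu / 2 * U) <= g0 * b by rewrite ler_pM2l.
have aU : a ^+ 2 * U <= g0 * mu * U by exact: ler_wpM2r.
by split => //; lra.
Qed.

(* [b] is the coupling force of the other player. In the estimate
   <hess f v, v> is dropped and <p, u> - bregman >= mu / 2 * |u|^2, with
   [u := x - xs] and [p := grad f x - grad f xs], absorbs the term in |u|^2. *)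
Lemma energy_rate_le f xs (mu a c beta gamma g0 : R) x v v2 b :
  strongly_convex mu f ->
  (forall y, differentiable f y) -> (forall y, differentiable (grad f) y) ->
  0 < mu -> 0 < a -> 0 < g0 -> g0 <= c -> a ^+ 2 <= g0 * mu -> 0 <= beta ->
  gamma = c + a * beta ->
  v2 + (2 * a) *: v + beta *: hess f x v
    + gamma *: (grad f x - grad f xs + b) = 0 ->
  energy_rate f xs a c beta x v v2 <=
  - a * energy f xs a c beta x v - gamma * inner b (a *: (x - xs) + v).
Proof.
move=> fc df dg mu0 a0 g00 g0c amu beta0 -> eqn.
have [b1 b2] := bregman_bounds xs x fc df.
have u0 := inner_ge0 (x - xs); have v0 := inner_ge0 v.
have h0 := hess_inner_ge0 v (ltW mu0) fc df (dg x).
rewrite /energy_rate /energy.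
have -> : v2 = - ((2 * a) *: v + beta *: hess f x v
    + (c + a * beta) *: (grad f x - grad f xs + b)).
  by apply/eqP; rewrite -addr_eq0 addrA addrA eqn.
move: b1 b2 u0 v0 h0.
move: (bregman f xs x) (hess f x v) (grad f x - _) (x - xs).
move=> br q p u b1 b2 u0 v0 h0.
have h0' : 0 <= beta * inner q v by exact: mulr_ge0.
rewrite !(innerDl, innerDr, innerNl, innerZl, innerZr) (innerC v u).
move: b1 b2 u0 v0 h0'.
move: (inner u u) (inner v v) (inner p u) (inner p v) (inner q u) (inner q v).
move: (inner u v) (inner b u) (inner b v).
move=> uv bu bv U V pu pv qu qv b1 b2 u0 v0 h0'.
have mU : 0 <= mu / 2 * U by rewrite mulr_ge0// divr_ge0// ltW.
have cb : g0 * (pu - br) <= c * (pu - br) by apply: ler_wpM2r => //; lra.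
have gb : g0 * (mu / 2 * U) <= g0 * (pu - br) by rewrite ler_pM2l.
have aU : a ^+ 2 * U <= g0 * mu * U by exact: ler_wpM2r.
have : 0 <= a * (c * (pu - br) - a ^+ 2 / 2 * U).
  by rewrite mulr_ge0 ?(ltW a0)//; lra.
have : 0 <= a * V by rewrite mulr_ge0 ?(ltW a0).
move=> aV aK; rewrite -subr_ge0; set rhs := (X in 0 <= X).
(* The force [b] drops out of the gap between the two sides, which splits into the strong convexity
   surplus, the Hessian damping and half of [a |v|^2]. *)
have -> : rhs = a * (c * (pu - br) - a ^+ 2 / 2 * U) + beta * qv
    + 2^-1 * (a * V).
  by rewrite /rhs; field.
by rewrite !addr_ge0// mulr_ge0.
Qed.

Lemma is_derive_energy f xs (a c beta : R) (x v : R -> X) (t : R) (v2 : X) :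
  (forall y, differentiable f y) -> (forall y, differentiable (grad f) y) ->
  is_derive t 1 x (v t) -> is_derive t 1 v v2 ->
  is_derive t 1 (fun s => energy f xs a c beta (x s) (v s))
    (energy_rate f xs a c beta (x t) (v t) v2).
Proof.
move=> df dg dx dv.
have dfx : is_derive t 1 (f \o x) (inner (grad f (x t)) (v t)).
  by rewrite inner_grad//; exact: is_derive_comp_diff.
have dgx : is_derive t 1 (grad f \o x) (hess f (x t) (v t)).
  exact: is_derive_comp_diff.
have du : is_derive t 1 (fun s => x s - xs) (v t).
  by apply: is_derive_eq; rewrite subr0.
have dp : is_derive t 1 (fun s => grad f (x s) - grad f xs)
    (hess f (x t) (v t)).
  by apply: is_derive_eq; rewrite subr0.
have dw : is_derive t 1 (fun s => a *: (x s - xs) + v s) (a *: v t + v2).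
  exact: is_derive_eq.
have dww := is_derive_inner dw dw.
have dpu := is_derive_inner dp du.
(* The linear part of the Bregman divergence is differentiated as an inner product with a constant
   curve; the resulting [inner 0 _] is removed below. *)
have dlin := is_derive_inner (is_derive_cst (grad f xs) t 1) du.
have db := is_deriveB (is_deriveB dfx (is_derive_cst (f xs) t 1)) dlin.
have dE := is_deriveD
  (is_deriveD (is_deriveZ c db) (is_deriveZ (a * beta) dpu))
  (is_deriveZ 2^-1 dww).
apply: (is_derive_eq dE); rewrite /energy_rate.
rewrite (innerC _ (a *: v t + v2)) /cst /=.
have pE : inner (grad f (x t) - grad f xs) (v t) =
    inner (grad f (x t)) (v t) - inner (grad f xs) (v t).
  by rewrite innerDl innerNl.
rewrite [inner 0 _]linear0l pE /GRing.scale /=.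
move: (inner (grad f xs) (v t)) (inner (grad f (x t)) (v t)) => p1 p2.
move: (inner (a *: v t + v2) (a *: (x t - xs) + v t)) => w.
by field.
Qed.

(** The filter is arbitrary so that the right-hand limit at the initial time is covered. *)
Lemma cvg_energy f xs (a c beta : R) (F : set_system R) (FF : Filter F)
    (x v : R -> X) x0 v0 :
  (forall y, differentiable f y) -> (forall y, differentiable (grad f) y) ->
  x @ F --> x0 -> v @ F --> v0 ->
  (fun s => energy f xs a c beta (x s) (v s)) @ F
    --> energy f xs a c beta x0 v0.
Proof.
move=> df dg xx vv.
have fx : f (x s) @[s --> F] --> f x0.
  by apply: cvg_comp xx _; exact: differentiable_continuous.
have gx : grad f (x s) @[s --> F] --> grad f x0.
  by apply: cvg_comp xx _; exact: differentiable_continuous.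
have uu : x s - xs @[s --> F] --> x0 - xs by apply: cvgB => //; exact: cvg_cst.
have ww : a *: (x s - xs) + v s @[s --> F] --> a *: (x0 - xs) + v0.
  by apply: cvgD => //; apply: cvgZ => //; exact: cvg_cst.
apply: cvgD; last by apply: cvgM; [exact: cvg_cst|exact: cvg_inner].
have pp : grad f (x s) - grad f xs @[s --> F] --> grad f x0 - grad f xs.
  by apply: cvgB; [exact: gx|exact: cvg_cst].
apply: cvgD; (apply: cvgM; first exact: cvg_cst); last exact: cvg_inner pp uu.
apply: cvgB; last exact: cvg_inner (cvg_cst _) uu.
by apply: cvgB; [exact: fx|exact: cvg_cst].
Qed.

End Energy.

(** * Decay from a differential inequality, and the adjoint operator *)

Lemma exponential_decay {R : realType} (E : R -> R) (a t0 : R) :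
  (forall t, t0 < t -> exists2 dE, is_derive t 1 E dE & dE <= - a * E t) ->
  E s @[s --> t0^'+] --> E t0 ->
  forall t, t0 <= t -> E t <= expR (a * t0) * E t0 * expR (- (a * t)).
Proof.
(* The integrating factor gives [G' = expR (a * s) * (a * E s + E' s) <= 0] after [t0]; right
   continuity extends the comparison to [t0] itself. *)
move=> dE Ec t t0t; pose G s := expR (a * s) * E s.
have dG s : t0 < s -> exists2 d, is_derive s 1 G d & d <= 0.
  move=> /dE [d Ed dle].
  exists (expR (a * s) * (a * E s + d)).
    have du : is_derive s 1 (fun s => a * s) a.
      by apply: is_derive_eq; rewrite /GRing.scale/= mulr1.
    have de := is_derive1_comp (is_derive_expR (a * s)) du.
    apply: (is_derive_eq (is_deriveM de Ed)).
    by rewrite /GRing.scale/=; ring.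
  by rewrite pmulr_rle0 ?expR_gt0//; lra.
have : G t <= G t0.
  apply: (@ler0_derive1_nincry _ G t0) => //.
  - by move=> s; rewrite in_itv/= andbT => /dG [d [] ].
  - move=> s; rewrite in_itv/= andbT => /dG [d Gd dle].
    by rewrite derive1E derive_val.
  apply/continuous_within_itvcyP; split.
    move=> s; rewrite in_itv/= andbT => /dG [d [Gd _] _].
    by apply: differentiable_continuous; apply/derivable1_diffP.
  apply: cvgM => //; apply: cvg_at_right_filter.
  apply: (@continuous_comp _ _ _ (fun s => a * s) expR);
    last exact: continuous_expR.
  by apply: cvgM; [exact: cvg_cst|exact: cvg_id].
rewrite /G -ler_pdivlMl ?expR_gt0// -expRN mulrC.
by [].
Qed.

(** For each [y], Riesz represents the functional sending [x] to [inner (A x) y]; choice assembles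
    the representatives into [At]. *)
Lemma adjoint_exists {R : realType} {X Y : hilbertType R}
    (A : {linear X -> Y}) :
  bounded_fun_norm A ->
  exists At : Y -> X, forall x y, inner (A x) y = inner (At y) x.
Proof.
(* Boundedness on the unit ball suffices for continuity of a linear map. *)
move=> /(_ 1) [M AM].
have Ac : continuous A.
  apply: bounded_linear_continuous; apply/ex_bound; exists M.
  by apply/nbhs_norm0P; exists 1 => //= u /ltW /AM.
suff /choice [At AtE] : forall y : Y, exists w : X,
    forall x, inner (A x) y = inner w x by exists At => x y.
move=> y; have lin : linear (fun x => inner (A x) y : R).
  by move=> k u v; rewrite linearP innerDl innerZl.
pose linM := GRing.isLinear.Build _ _ _ _ _ lin.
pose l : {linear X -> R} := HB.pack (fun x => inner (A x) y : R) linM.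
have lc : continuous l.
  by move=> x; apply: cvg_inner; [exact: Ac|exact: cvg_cst].
exact: riesz_representation lc.
Qed.

(** * Partial gradients and Hessians of the Lagrangian *)

Section Lagrangian.
Context {R : realType} {X Y : hilbertType R}.
Context (f : X -> R) (g : Y -> R) (A : X -> Y) (At : Y -> X).
Context (AtE : forall x y, inner (A x) y = inner (At y) x).
Local Notation L := (lagrangian f g A).

Let L_x u y : L u y = 1 * f u + inner (At y) u + - g y.
Proof. by rewrite /lagrangian AtE mul1r. Qed.

Let L_y x u : L x u = - 1 * g u + inner (A x) u + f x.
Proof. by rewrite /lagrangian mulN1r; ring. Qed.

Lemma grad_x_lagrangian x y : differentiable f x ->
  grad_x L x y = grad f x + At y.
Proof.
move=> df; rewrite /grad_x.
by rewrite (grad_affine_perturbation df (L_x^~ y)) scale1r.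
Qed.

Lemma grad_y_lagrangian x y : differentiable g y ->
  grad_y L x y = A x - grad g y.
Proof.
move=> dg; rewrite /grad_y.
by rewrite (grad_affine_perturbation dg (L_y x)) scaleN1r addrC.
Qed.

Lemma hess_xx_lagrangian x y h :
  (forall u, differentiable f u) -> differentiable (grad f) x ->
  hess_xx L x y h = hess f x h.
Proof.
move=> df dgf; rewrite /hess_xx.
by rewrite (hess_affine_perturbation _ df dgf (L_x^~ y)) scale1r.
Qed.

Lemma hess_yy_lagrangian x y h :
  (forall u, differentiable g u) -> differentiable (grad g) y ->
  hess_yy L x y h = - hess g y h.
Proof.
move=> dg dgg; rewrite /hess_yy.
by rewrite (hess_affine_perturbation _ dg dgg (L_y x)) scaleN1r.
Qed.

End Lagrangian.

(** * Decay of the total energy and the three rates *)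

Theorem theorem15 (R : realType) (X Y : hilbertType R)
    (f : X -> R) (g : Y -> R) (mu_f mu_g : R)
    (f_C2 : twice_cont_diff f) (g_C2 : twice_cont_diff g)
    (mu_f_gt0 : 0 < mu_f) (mu_g_gt0 : 0 < mu_g)
    (f_sc : strongly_convex mu_f f) (g_sc : strongly_convex mu_g g)
    (A : {linear X -> Y}) (A_bounded : bounded_fun_norm A)
    (xs : X) (ys : Y) (xys_saddle : saddle_point (lagrangian f g A) xs ys)
    (t0 gamma0 alpha beta_f beta_g gamma theta : R)
    (t0_ge0 : 0 <= t0) (gamma0_gt0 : 0 < gamma0)
    (alpha_gt0 : 0 < alpha)
    (alpha_le : alpha <= 2 * Num.sqrt (Num.min mu_f mu_g * gamma0))
    (beta_gt0 : 0 < Num.min beta_f beta_g)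
    (gammaE : gamma = gamma0 + alpha / 2 * Num.max beta_f beta_g)
    (thetaE : theta = 2 / alpha)
    (x : R -> X) (y : R -> Y)
    (xy_sol : system_solution (lagrangian f g A)
                t0 alpha beta_f beta_g gamma theta x y) :
  let rate := fun t : R => expR (- (1 / 2 * alpha * t)) in
  [/\ bigO_on `[t0, +oo[
        (fun t => `|x t - xs| ^+ 2 + `|y t - ys| ^+ 2) rate,
      bigO_on `[t0, +oo[
        (fun t => `|derive_on `[t0, +oo[ x t| ^+ 2
                  + `|derive_on `[t0, +oo[ y t| ^+ 2) rate &
      bigO_on `[t0, +oo[
        (fun t => lagrangian f g A (x t) ys - lagrangian f g A xs (y t)) rate].
Proof.
have [[df _] [dgf _]] := f_C2; have [[dg _] [dgg _]] := g_C2.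
have [At AtE] := adjoint_exists A_bounded.
(* The saddle inequalities say that [xs] minimizes [L(., ys)] and [ys] minimizes [- L(xs, .)]; the
   next two facts are the first-order conditions. *)
have gradfs : grad f xs = - At ys.
  apply: grad_minimizer => // u; have [_ +] := xys_saddle u ys.
  by rewrite /lagrangian !AtE; lra.
have gradgs : grad g ys = A xs.
  rewrite -[RHS]opprK; apply: grad_minimizer => // u.
  have [+ _] := xys_saddle xs u.
  by rewrite /lagrangian !innerNl; lra.
pose a := alpha / 2.
have a0 : 0 < a by rewrite divr_gt0.
have [bf0 bg0] : 0 < beta_f /\ 0 < beta_g.
  by move: beta_gt0; rewrite lt_min => /andP.
have amin : a ^+ 2 <= gamma0 * Num.min mu_f mu_g.
  have m0 : 0 < Num.min mu_f mu_g * gamma0.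
    by rewrite mulr_gt0// lt_min mu_f_gt0.
  rewrite mulrC -(sqr_sqrtr (ltW m0)) ler_pXn2r ?nnegrE ?sqrtr_ge0 ?(ltW a0)//.
  by rewrite /a; lra.
have amuf : a ^+ 2 <= gamma0 * mu_f.
  by apply: le_trans amin _; rewrite ler_pM2l// ge_min lexx.
have amug : a ^+ 2 <= gamma0 * mu_g.
  by apply: le_trans amin _; rewrite ler_pM2l// ge_min lexx orbT.
(* These are the Bregman coefficients of the two energies. The maximum in [gamma] makes both at
   least [gamma0]. *)
pose cf := gamma - a * beta_f; pose cg := gamma - a * beta_g.
have cf0 : gamma0 <= cf.
  by rewrite /cf gammaE -addrA lerDl subr_ge0 ler_pM2l// le_max lexx.
have cg0 : gamma0 <= cg.
  by rewrite /cg gammaE -addrA lerDl subr_ge0 ler_pM2l// le_max lexx orbT.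
have gammaf : gamma = cf + a * beta_f by rewrite subrK.
have gammag : gamma = cg + a * beta_g by rewrite subrK.
have alphaE : alpha = 2 * a by rewrite /a; field.
have thetaa : a * theta = 1 by rewrite thetaE /a; field; rewrite gt_eqF.
set I := `[t0, +oo[%classic.
have [] := xy_sol; rewrite -/I.
set x1 := derive_on I x; set x2 := derive_on I x1.
set y1 := derive_on I y; set y2 := derive_on I y1 => dx dy eqns.
have It t : t0 <= t -> I t by move=> ?; rewrite /I /= in_itv/= andbT.
pose E t := energy f xs a cf beta_f (x t) (x1 t)
  + energy g ys a cg beta_g (y t) (y1 t).
(* The equations of motion are recentred at the saddle point: by the optimality conditions, the
   subtracted gradient and the constant added to the coupling force cancel. *)
have eqx t : I t -> x2 t + (2 * a) *: x1 t + beta_f *: hess f (x t) (x1 t)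
    + gamma *: (grad f (x t) - grad f xs
                + (At (y t + theta *: y1 t) - At ys)) = 0.
  move=> /eqns [+ _].
  rewrite (hess_xx_lagrangian _ AtE _ _ df (dgf _))
    (grad_x_lagrangian _ AtE _ (df _)).
  rewrite -alphaE gradfs; move: (grad f (x t)) (At ys) (At _) => p r q.
  by rewrite opprK addrACA subrr addr0.
have eqy t : I t -> y2 t + (2 * a) *: y1 t + beta_g *: hess g (y t) (y1 t)
    + gamma *: (grad g (y t) - grad g ys
                + (A xs - A (x t + theta *: x1 t))) = 0.
  move=> /eqns [_ +].
  rewrite (hess_yy_lagrangian _ _ _ _ dg (dgg _))
    (grad_y_lagrangian _ _ _ (dg _)).
  rewrite -alphaE gradgs; move: (grad g (y t)) (A xs) (A _) => p r q.
  by rewrite addrA subrK scalerN opprK -scalerN opprB.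
have coupling t :
    inner (At (y t + theta *: y1 t) - At ys) (a *: (x t - xs) + x1 t)
    + inner (A xs - A (x t + theta *: x1 t)) (a *: (y t - ys) + y1 t) = 0.
  (* Since [a * theta = 1], the vectors paired with the forces are [a] times these extrapolated
     displacements, and the two terms become [a <A zx, zy>] and its opposite. *)
  pose zx := x t - xs + theta *: x1 t; pose zy := y t - ys + theta *: y1 t.
  have -> : a *: (x t - xs) + x1 t = a *: zx.
    by rewrite /zx [RHS]scalerDr scalerA thetaa scale1r.
  have -> : a *: (y t - ys) + y1 t = a *: zy.
    by rewrite /zy [RHS]scalerDr scalerA thetaa scale1r.
  have -> : A xs - A (x t + theta *: x1 t) = - A zx.
    by rewrite /zx addrAC linearB opprB.
  rewrite innerDl innerNl -!AtE -innerNr -innerDr.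
  have -> : y t + theta *: y1 t - ys = zy by rewrite addrAC.
  by rewrite linearZ innerNl innerZl innerZr subrr.
have Edecay t : I t -> E t <= expR (a * t0) * E t0 * expR (- (a * t)).
  rewrite /I/= in_itv/= andbT; apply: exponential_decay.
    move=> s t0s; have Is : I s by apply: It; exact: ltW.
    (* After [t0] the time interval is a neighbourhood of [s], so the one-sided derivatives are
       ordinary ones. *)
    have nI : \near s, I s.
      near=> r; apply: It; apply: ltW; near: r; exact: lt_nbhsr.
    have [dxs dx1s] := dx s Is; have [dys dy1s] := dy s Is.
    have := is_deriveD
      (is_derive_energy xs a cf beta_f df dgf
         (is_derive_derive_on nI dxs) (is_derive_derive_on nI dx1s))
      (is_derive_energy ys a cg beta_g dg dgg
         (is_derive_derive_on nI dys) (is_derive_derive_on nI dy1s)).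
    move=> dE; eexists; first exact: dE.
    have ex := energy_rate_le f_sc df dgf mu_f_gt0 a0 gamma0_gt0 cf0 amuf
      (ltW bf0) gammaf (eqx s Is).
    have ey := energy_rate_le g_sc dg dgg mu_g_gt0 a0 gamma0_gt0 cg0 amug
      (ltW bg0) gammag (eqy s Is).
    apply: le_trans (lerD ex ey) _; rewrite addrACA -opprD
      -[_ * _ + gamma * _]mulrDr.
    by rewrite coupling mulr0 subr0 -mulrDr.
  have [dxs dx1s] := dx t0 (It _ (lexx _)).
  have [dys dy1s] := dy t0 (It _ (lexx _)).
  by apply: cvgD; apply: cvg_energy => //; exact: cvg_at_right_derivable_on.
move=> rate; pose C := expR (a * t0) * E t0.
have rateE t : rate t = expR (- (a * t)).
  by rewrite /rate /a; congr (expR (- _)); field.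
have bnd_x t := energy_bounds xs (x t) (x1 t) f_sc df
  mu_f_gt0 a0 gamma0_gt0 cf0 amuf (ltW bf0).
have bnd_y t := energy_bounds ys (y t) (y1 t) g_sc dg
  mu_g_gt0 a0 gamma0_gt0 cg0 amug (ltW bg0).
split.
(* Here and in the next two items the constant is that of [energy_bounds] times [C], with the bounds
   for the two players added. *)
- exists (2 * C / a ^+ 2) => t /Edecay; rewrite rateE -/C => Et.
  have [_ _ h1 _] := bnd_x t; have [_ _ h2 _] := bnd_y t.
  rewrite ger0_norm; last by rewrite addr_ge0 ?sqr_ge0.
  rewrite mulrAC ler_pdivlMr ?exprn_gt0// -!inner_norm mulrC mulrDr.
  apply: le_trans (lerD h1 h2) _; rewrite -mulrDr -mulrA ler_pM2l//.
- exists (8 * C) => t /Edecay; rewrite rateE -/C => Et.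
  have [_ _ _ h1] := bnd_x t; have [_ _ _ h2] := bnd_y t.
  rewrite ger0_norm; last by rewrite addr_ge0 ?sqr_ge0.
  rewrite -!inner_norm; apply: le_trans (lerD h1 h2) _.
  by rewrite -mulrDr -mulrA ler_pM2l.
- exists (C / gamma0) => t /Edecay; rewrite rateE -/C => Et.
  have [p1 h1 _ _] := bnd_x t; have [p2 h2 _ _] := bnd_y t.
  (* By the optimality conditions the primal-dual gap is exactly the sum of the two Bregman
     divergences, hence nonnegative and controlled by the energy. *)
  have -> : lagrangian f g A (x t) ys - lagrangian f g A xs (y t)
      = bregman f xs (x t) + bregman g ys (y t).
    rewrite /bregman /lagrangian gradfs gradgs !innerNl innerDr innerNr.
    rewrite innerDr innerNr -!AtE; ring.
  rewrite ger0_norm; last by rewrite addr_ge0.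
  rewrite mulrAC ler_pdivlMr// mulrC mulrDr.
  exact: le_trans (lerD h1 h2) _.
Unshelve. all: by end_near. Qed.
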